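(* Let $k,n,L$ be fixed positive integers with $2k<n$. Then, as $q\to\infty$ over prime powers, there exists an $[n,k,L]_q$-AS family of size at least $$q^{\,n-2k-\frac{(n-k)(k+1)}{L+1}}\,(1+o(1)).$$ Consequently, for fixed $L$, $$p^{AS}(n,k,L)\ge n-2k-\frac{(n-k)(k+1)}{L+1}.$$
   Context: Let $q$ be a prime power and $\mathbb{F}_q$ the field with $q$ elements. A partial $k$-spread in $\mathbb{F}_q^n$ is a collection of $k$-dimensional linear subspaces with pairwise trivial intersection (i.e. equal to $\{0\}$). For positive integers $k,n$ with $2k<n$, a family $\mathcal{F}$ of $k$-dimensional linear subspaces of $\mathbb{F}_q^n$ is $L$-almost sparse, written $[n,k,L]_q$-AS, if (1) $\mathcal{F}$ is a partial $k$-spread of $\mathbb{F}_q^n$, and (2) every $(k+1)$-dimensional linear subspace of $\mathbb{F}_q^n$ intersects non-trivially (in more than $\{0\}$) at most $L$ subspaces from $\mathcal{F}$. $m^{AS}_q(n,k,L)$ denotes the maximal cardinality of an $[n,k,L]_q$-AS family, and $$p^{AS}(n,k,L):=\limsup_{q\to\infty}\log_q\big(m^{AS}_q(n,k,L)\big),$$ with $q$ ranging over prime powers. The term $o(1)$ is a quantity tending to $0$ as $q\to\infty$ with $k,n,L$ fixed. *)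

(* Defs.v *)
From HB Require Import structures.
From mathcomp Require Import all_boot all_order all_algebra all_field.
From mathcomp Require Import all_classical all_reals all_analysis.

Set Implicit Arguments.
Unset Strict Implicit.
Unset Printing Implicit Defensive.

Import Order.TTheory GRing.Theory Num.Theory.
Import numFieldNormedType.Exports.

Local Open Scope ring_scope.
Local Open Scope classical_set_scope.

(* The library only makes {vspace vT} a choiceType.  Over a finite field it is *)
(* finite, so that families of subspaces can be taken in {set {vspace vT}}.    *)
Section VspaceFinite.
Import VectorInternalTheory.
Variables (F : finFieldType) (vT : vectType F).
HB.instance Definition _ := [Countable of {vspace vT} by <:].
HB.instance Definition _ := [Finite of {vspace vT} by <:].
End VspaceFinite.

Section AlmostSparse.
Variables (F : finFieldType) (n : nat).
Implicit Types (k L : nat) (Fam : {set {vspace 'rV[F]_n}}).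

Definition partial_spread k Fam : bool :=
  [forall U in Fam, \dim U == k] &&
  [forall U in Fam, forall V in Fam, (U != V) ==> ((U :&: V)%VS == 0%VS)].

Definition almost_sparse k L Fam : bool :=
  partial_spread k Fam &&
  [forall W : {vspace 'rV[F]_n}, (\dim W == k.+1) ==>
     (#|[set U in Fam | (U :&: W)%VS != 0%VS]| <= L)%N].

End AlmostSparse.

Definition prime_power : set nat :=
  [set q | exists p e : nat, [/\ prime p, (0 < e)%N & q = (p ^ e)%N]].

Lemma finField_of_card (q : nat) :
  prime_power q -> {F : finFieldType | #|F| = q}.
Proof.
move=> /cid[p /cid[e [p_pr e_gt0 ->]]].
by have [F _ cardF] := pPrimePowerField p_pr e_gt0; exists F.
Qed.

(* A chosen field with q elements; the value 'F_2 is junk, used when q is not  *)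
(* a prime power.                                                              *)
Definition Fq (q : nat) : finFieldType :=
  if pselect (prime_power q) is left h then sval (finField_of_card h)
  else 'F_2.

Lemma card_Fq (q : nat) : prime_power q -> #|Fq q| = q.
Proof.
by rewrite /Fq => q_pp; case: pselect => // h; apply: svalP (finField_of_card h).
Qed.

Definition mAS (q n k L : nat) : nat :=
  \max_(Fam : {set {vspace 'rV[Fq q]_n}} | almost_sparse k L Fam) #|Fam|.

(* The quotient of logarithms is log_q (mAS q n k L). *)
Definition pAS (R : realType) (n k L : nat) : \bar R :=
  limf_esup (fun q : nat => (ln (mAS q n k L)%:R / ln q%:R)%:E)
            (within prime_power \oo).

(* Main.v *)
(* Choose the graphs {(x, xA)} of k x r matrices A, with r = n - k, one at a time.
   A fixed (k+1)-space W meets the graph of A for at most 2 q^(k+(k-1)r) of the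
   q^(kr) matrices, and likewise for the graphs already chosen, so at least half
   of the matrices stay available.  Averaging over these, the next A can be
   chosen so that the potential sum_W lam^(number of chosen graphs meeting W)
   grows by a factor at most 1 + 1/m, where lam = q^(r(k+1)/(L+1)) / 8 and
   q^e <= m <= 2 q^e.  After m steps the potential is at most exp(1) times the
   number of W's, which is below lam^(L+1), so no W meets L+1 chosen graphs.  For
   negative exponents e a single subspace suffices. *)
Require Import Defs.
From mathcomp Require Import all_boot all_order all_algebra all_field.
From mathcomp Require Import all_classical all_reals all_analysis.
From mathcomp Require Import ring lra zify.
Import Order.TTheory GRing.Theory Num.Theory.
Import numFieldNormedType.Exports.
Local Open Scope ring_scope.
Local Open Scope classical_set_scope.

Set Implicit Arguments.
Unset Strict Implicit.
Unset Printing Implicit Defensive.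

(** * Greedy selection under an exponential potential *)

Lemma card_bigcup_le (T I : finType) (S : {set I}) (F : I -> {set T}) (b : nat) :
  (forall i, i \in S -> (#|F i| <= b)%N) ->
  (#|(\bigcup_(i in S) F i)%SET| <= #|S| * b)%N.
Proof.
move=> Fb; rewrite -sum_nat_const.
apply: (@leq_trans (\sum_(i in S) #|F i|)); last exact: leq_sum.
apply: (big_ind2 (fun (A : {set T}) (c : nat) => #|A| <= c)%N) => //; first by rewrite cards0.
move=> A a B c Aa Bc; apply: leq_trans (leq_add Aa Bc).
by rewrite cardsU leq_subr.
Qed.

(** The condition 2 lam b m <= |T| does two jobs. As s <= m and lam >= 1, clashes exclude at most
    half of [T]; and the half left has at least lam b m elements, so the average relative growth is
    at most (lam - 1) b / (lam b m) < 1/m. *)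
Lemma greedy_family (R : realFieldType) (T J : finType) (D : {set J})
    (hit : J -> pred T) (clash : rel T) (b m : nat) (lam : R) :
  1 <= lam -> (0 < m)%N -> (0 < #|T|)%N -> symmetric clash -> reflexive clash ->
  (forall t, #|[set u | clash t u]%SET| <= b)%N ->
  (forall j, j \in D -> #|[set t | hit j t]%SET| <= b)%N ->
  2 * lam * b%:R * m%:R <= #|T|%:R ->
  forall s, (s <= m)%N -> exists S : {set T},
  [/\ #|S| = s,
      {in S &, forall t u, t != u -> ~~ clash t u} &
      \sum_(j in D) lam ^+ #|[set t in S | hit j t]%SET|
        <= #|D|%:R * (1 + m%:R^-1) ^+ s].
Proof.
move=> lam1 m0 T0 clashC clashR clash_b hit_b lbm; elim=> [_|s IHs s_lt_m].
  exists (finset.set0); split; first by rewrite cards0.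
    by move=> t u; rewrite finset.in_set0.
  rewrite expr0 mulr1 (eq_bigr (fun=> 1)) ?sumr_const // => j _.
  rewrite (_ : finset _ = finset.set0) ?cards0 //.
  by apply/setP => t; rewrite !finset.inE.
have [S [cardS clashS sumS]] := IHs (ltnW s_lt_m).
pose Phi := \sum_(j in D) lam ^+ #|[set t in S | hit j t]%SET|.
have lam0 : 0 < lam by rewrite (lt_le_trans ltr01).
have m0R : 0 < m%:R :> R by rewrite ltr0n.
have T0R : 0 < #|T|%:R :> R by rewrite ltr0n.
have Phi0 : 0 <= Phi by apply: sumr_ge0 => j _; rewrite exprn_ge0 // ltW.
pose O := [set u | [forall t in S, ~~ clash t u]]%SET.
have cardO : (#|T| <= #|O| + s * b)%N.
  rewrite -(cardsC O) leq_add2l -cardS.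
  apply: leq_trans (card_bigcup_le (F := fun t => [set u | clash t u]%SET) _);
    last by move=> t _; exact: clash_b.
  apply/subset_leq_card/fintype.subsetP => u; rewrite !finset.inE negb_forall_in.
  by case/exists_inP => t tS; rewrite negbK => ctu;
  apply/finset.bigcupP; exists t; rewrite ?finset.inE.
have halfO : #|T|%:R <= 2 * #|O|%:R :> R.
  have : #|T|%:R <= #|O|%:R + s%:R * b%:R :> R by rewrite -natrM -natrD ler_nat.
  have : s%:R * b%:R <= lam * b%:R * m%:R :> R.
    rewrite mulrAC mulrC mulrC ler_wpM2r // -[s%:R]mul1r ler_pM //.
    by rewrite ler_nat ltnW.
  lra.
have O0R : 0 < #|O|%:R :> R by lra.
(* Adding u multiplies by lam exactly the terms that u hits. Reflexivity of [clash] makes u new, so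
   each such count rises by one. *)
have stepE u : u \in O ->
    \sum_(j in D) lam ^+ #|[set t in u |: S | hit j t]%SET| =
    Phi + (lam - 1) * \sum_(j in D)
      (hit j u)%:R * lam ^+ #|[set t in S | hit j t]%SET|.
  move=> uO; rewrite mulr_sumr -big_split /=; apply: eq_bigr => j _.
  have uS : u \notin S.
    by apply: contraL uO => uS; rewrite finset.inE negb_forall_in; apply/exists_inP;
      exists u => //; rewrite clashR.
  case: (boolP (hit j u)) => hju /=; last first.
    rewrite mul0r mulr0 addr0; congr (_ ^+ #|pred_of_set _|).
    apply/setP => t; rewrite !finset.inE; case: eqVneq => // ->.
    by rewrite (negbTE hju) !andbF.
  rewrite (_ : finset _ = u |: [set t in S | hit j t])%SET; last first.
    by apply/setP => t; rewrite !finset.inE; case: eqVneq => // ->; rewrite hju.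
  by rewrite cardsU1 finset.inE (negbTE uS) /= add1n exprS mul1r mulrBl mul1r addrC subrK.
(* Otherwise the sum over [O] would exceed |O| Phi (1 + 1/m). After exchanging sums, each j is hit
   by at most b candidates, so the total increase is at most (lam - 1) b Phi <= |O| Phi / m. *)
have [u uO u_le] : exists2 u, u \in O &
    \sum_(j in D) lam ^+ #|[set t in u |: S | hit j t]%SET| <= Phi * (1 + m%:R^-1).
  apply/exists_inP; apply: contraT; rewrite negb_exists_in => /forall_inP big.
  have [u0 u0O] : exists u, u \in O.
    by apply/card_gt0P; rewrite -(ltr0n R).
  have : \sum_(u in O) Phi * (1 + m%:R^-1) <
     \sum_(u in O) \sum_(j in D) lam ^+ #|[set t in u |: S | hit j t]%SET|.
    rewrite (bigD1 u0) //= [ltRHS](bigD1 u0) //=; apply: ltr_leD.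
      by rewrite ltNge big.
    by apply: ler_sum => u /andP[uO _]; rewrite ltW // ltNge big.
  rewrite (eq_bigr _ stepE) big_split /= !sumr_const -mulr_sumr exchange_big /=.
  rewrite -[_ *+ _]mulr_natr -[X in _ < X + _]mulr_natr => lt1.
  have le2 : \sum_(j in D) \sum_(u in O) (hit j u)%:R *
       lam ^+ #|[set t in S | hit j t]%SET| <= b%:R * Phi.
    rewrite mulr_sumr; apply: ler_sum => j jD.
    rewrite -mulr_suml ler_wpM2r ?exprn_ge0 ?(ltW lam0) //.
    rewrite -natr_sum ler_nat; apply: leq_trans (hit_b j jD).
    rewrite -sum1dep_card big_mkcond [X in (_ <= X)%N]big_mkcond /=.
    apply: leq_sum => u _; case: (u \in O); case: (hit j u) => //.
  have le3 : (lam - 1) * (b%:R * Phi) <= #|O|%:R * m%:R^-1 * Phi.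
    rewrite mulrA ler_wpM2r // ler_pdivlMr //.
    have : 0 <= b%:R * m%:R :> R by rewrite -natrM.
    nra.
  have := ler_wpM2l (_ : 0 <= lam - 1) le2; rewrite subr_ge0 => /(_ lam1).
  lra.
exists (u |: S)%SET; split.
- rewrite cardsU1 cardS (_ : u \notin S) //.
  by apply: contraL uO => uS; rewrite finset.inE negb_forall_in; apply/exists_inP;
      exists u => //; rewrite clashR.
- have uS t : t \in S -> ~~ clash t u.
    by move: uO; rewrite finset.inE => /forall_inP; apply.
  move=> t v; rewrite !finset.inE => /orP[/eqP->|tS] /orP[/eqP->|vS].
  + by rewrite eqxx.
  + by rewrite clashC => _; exact: uS.
  + by move=> _; exact: uS.
  + exact: clashS.
- apply: le_trans u_le _; rewrite exprSr mulrA ler_wpM2r //.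
Qed.

(** * Counting subspaces of a given dimension *)

(** The order of GL_n is q^C(n,2) times the product of q^i - 1 for 1 <= i <= n. Each factor is at
    least q^i / 2, and n^2 = C(n,2) + C(n+1,2). *)
Lemma card_GL_ge (F : finFieldType) (d : nat) :
  (#|F| ^ (d.+1 * d.+1) <= 2 ^ d.+1 * #|[set M : 'M[F]_d.+1 | M \in unitmx]%SET|)%N.
Proof.
have q2 := finNzRing_gt1 F.
apply: (@leq_trans (2 ^ d.+1 * #|'GL_d.+1[F]%g|)); last first.
  rewrite leq_mul2l expn_eq0 /=.
  have valI : injective (@GLval d.+1 F) by exact: val_inj.
  rewrite -(card_imset _ valI); apply/subset_leq_card/fintype.subsetP => M.
  by case/imsetP => g _ ->; rewrite finset.inE; exact: (valP g).
rewrite card_GL //; set q := #|F| in q2 *.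
rewrite (_ : (d.+1 * d.+1 = 'C(d.+1, 2) + 'C(d.+2, 2))%N); last first.
  rewrite !bin2 /=; have := odd_double_half (d.+1 * d); have := odd_double_half (d.+2 * d.+1).
  rewrite !oddM /= -!divn2; case: (odd d); rewrite /= ?andbF /=; lia.
rewrite expnD mulnCA leq_mul2l; apply/orP; right.
rewrite -bin2_sum.
elim: d.+1 => [|e IH].
  by rewrite big_nat1 big_geq.
rewrite big_nat_recr //= [X in (_ <= _ * X)%N]big_nat_recr //= expnS.
rewrite expnD (mulnC 2) mulnACA leq_mul //.
have : (0 < q ^ e.+1)%N by rewrite expn_gt0 (ltnW q2).
have : (1 < q ^ e.+1)%N by rewrite -[X in (X < _)%N](exp1n e.+1) ltn_exp2r.
lia.
Qed.

Section RowSpace.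
Variables (F : finFieldType) (d n : nat).
Implicit Types M : 'M[F]_(d, n).

Definition rowspace M : {vspace 'rV[F]_n} := limg (linfun (mulmxr M : 'rV_d -> 'rV_n)).

Lemma rowspaceP M w : reflect (exists x, w = x *m M) (w \in rowspace M).
Proof.
apply: (iffP memv_imgP) => [[x _ ->]|[x ->]]; exists x; rewrite ?memvf ?lfunE //.
Qed.

Lemma dim_rowspace M : injective (fun x : 'rV_d => x *m M) -> \dim (rowspace M) = d.
Proof.
move=> injM; rewrite limg_dim_eq; first by rewrite dimvf /dim /= mul1n.
apply/eqP; rewrite -subv0; apply/subvP => x; rewrite memv_cap memv_ker lfunE /=.
by case/andP => _ /eqP xM; rewrite memv0; apply/eqP/injM; rewrite xM mul0mx.
Qed.

Lemma dim_rowspace_inj M : \dim (rowspace M) = d -> injective (fun x : 'rV_d => x *m M).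
Proof.
move=> dimM; suff ker0 : lker (linfun (mulmxr M : 'rV_d -> 'rV_n)) == 0%VS.
  by move=> x y /= exy; apply: (lker0P ker0); rewrite !lfunE.
have := limg_ker_dim (linfun (mulmxr M : 'rV_d -> 'rV_n)) fullv.
rewrite -/(rowspace M) dimM capfv dimvf /= /dim /= mul1n => /eqP.
by rewrite -[X in _ == X]add0n eqn_add2r dimv_eq0.
Qed.

Lemma rowspace_mul (g : 'M[F]_d) M : g \in unitmx -> rowspace (g *m M) = rowspace M.
Proof.
move=> gU; apply/vspaceP => w; apply/rowspaceP/rowspaceP => -[x ->].
  by exists (x *m g); rewrite mulmxA.
by exists (x *m invmx g); rewrite mulmxA mulmxKV.
Qed.

End RowSpace.

Lemma rowspace_surj (F : finFieldType) (d n : nat) (W : {vspace 'rV[F]_n}) :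
  \dim W = d -> exists M : 'M[F]_(d, n), rowspace M = W.
Proof.
move=> <- {d}; exists (\matrix_(i < \dim W) ((vbasis W)`_i)).
apply/vspaceP => w; apply/rowspaceP/idP => [[x ->]|wW].
  rewrite mulmx_sum_row rpred_sum // => i _; rewrite rowK rpredZ //.
  by apply: vbasis_mem; rewrite mem_nth // size_tuple.
rewrite (coord_vbasis wW); exists (\row_(i < \dim W) coord (vbasis W) i w).
by rewrite mulmx_sum_row; apply: eq_bigr => i _; rewrite rowK mxE.
Qed.

(** The fibre of [rowspace] over W contains g M for every invertible g, where M is one basis matrix
    of W. These products are distinct because the rows of M are independent. *)
Lemma card_dim_vspace_unitmx (F : finFieldType) (d n : nat) :
  (#|[set W : {vspace 'rV[F]_n} | \dim W == d]%SET| *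
   #|[set g : 'M[F]_d | g \in unitmx]%SET| <= #|F| ^ (d * n))%N.
Proof.
rewrite -card_mx -[X in (_ <= X)%N]sum1_card.
rewrite (partition_big (@rowspace F d n) predT) //= -sum_nat_const.
rewrite [X in (_ <= X)%N](bigID (mem [set W : {vspace 'rV[F]_n} | \dim W == d]%SET)) /=.
apply: leq_trans (leq_addr _ _); apply: leq_sum => W.
rewrite finset.inE => /eqP dimW; have [M MW] := rowspace_surj dimW.
have mulI : injective (fun g : 'M[F]_d => g *m M).
  move=> g h /= egh; apply/row_matrixP => i.
  by apply: (dim_rowspace_inj (M := M)); rewrite ?MW // -!row_mul egh.
rewrite sum1dep_card -(card_imset _ mulI); apply/subset_leq_card/fintype.subsetP => N.
by case/imsetP => g; rewrite finset.inE => gU ->; rewrite finset.inE rowspace_mul // MW.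
Qed.

(** An upper bound for the Gaussian binomial coefficient, with the denominator multiplied out so
    that no truncated subtraction occurs in an exponent. *)
Lemma card_dim_vspace_le (F : finFieldType) (d n : nat) :
  (#|[set W : {vspace 'rV[F]_n} | \dim W == d.+1]%SET| * #|F| ^ (d.+1 * d.+1)
   <= 2 ^ d.+1 * #|F| ^ (d.+1 * n))%N.
Proof.
apply: leq_trans (leq_mul (leqnn _) (card_GL_ge F d)) _.
by rewrite mulnCA leq_mul2l card_dim_vspace_unitmx orbT.
Qed.

(** * Graphs of matrices and their intersections *)

Section Graph.
Variables (F : finFieldType) (k r : nat).

Definition graph (A : 'M[F]_(k, r)) : {vspace 'rV[F]_(k + r)} := rowspace (row_mx 1%:M A).

Lemma dim_graph A : \dim (graph A) = k.
Proof.
apply: dim_rowspace => x y /=; rewrite !mul_mx_row !mulmx1.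
by case/eq_row_mx.
Qed.

Lemma mem_graph A w : (w \in graph A) = (lsubmx w *m A == rsubmx w).
Proof.
apply/rowspaceP/eqP => [[x ->]|wA].
  by rewrite mul_mx_row mulmx1 row_mxKl row_mxKr.
by exists (lsubmx w); rewrite mul_mx_row mulmx1 wA hsubmxK.
Qed.

(** Write w = (x, y), so that membership means x A = y. If x = 0 then y is nonzero and no A works.
    If x_i is nonzero, row i of A is determined by the other rows, so deleting it is injective. *)
Lemma card_graph_mem w : w != 0 ->
  (#|[set A | w \in graph A]%SET| <= #|F| ^ (k.-1 * r))%N.
Proof.
move=> w0; have [x0|/rV0Pn[i xi0]] := eqVneq (lsubmx w) 0.
  rewrite (_ : finset _ = finset.set0) ?cards0 //; apply/setP => A.
  rewrite !finset.inE mem_graph x0 mul0mx eq_sym; apply: contraNF w0 => /eqP y0.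
  by rewrite -[w]hsubmxK x0 y0 row_mx0.
rewrite -card_mx -(card_in_imset (f := row' i)) ?max_card // => A B.
rewrite !finset.inE !mem_graph => /eqP Aw /eqP Bw ABi.
apply/row_matrixP => j.
have AB j' : row (lift i j') A = row (lift i j') B.
  by apply/rowP => c; move/matrixP/(_ j' c): ABi; rewrite !mxE.
have [j' ->|->] := unliftP i j; first exact: AB.
have : lsubmx w *m A = lsubmx w *m B by rewrite Aw Bw.
rewrite !mulmx_sum_row (bigD1 i) //= [RHS](bigD1 i) //=.
rewrite (eq_bigr (fun j => lsubmx w 0 j *: row j B)) => [|l].
  by move/addIr/(scalerI xi0).
by have [l' ->|->] := unliftP i l; rewrite ?eqxx // AB.
Qed.

(* Each counted subspace contains at least q - 1 nonzero vectors of X; dividing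
   by q - 1 saves a factor of about q, without which the exponent e is lost. *)
Lemma card_graph_meet d (X : {vspace 'rV[F]_(k + r)}) : (\dim X <= d.+1)%N ->
  (#|[set A | (graph A :&: X)%VS != 0%VS]%SET| <= 2 * #|F| ^ (d + k.-1 * r))%N.
Proof.
move=> dimX; have q2 := finNzRing_gt1 F.
set B := finset _; have count : (#|B| * #|F|.-1 <= #|F| ^ (d.+1 + k.-1 * r))%N.
  rewrite -sum_nat_const.
  apply: (@leq_trans (\sum_(A in B) \sum_(w : 'rV[F]_(k + r) | (w \in X) && (w != 0%R))
    (w \in graph A))).
    apply: leq_sum => A; rewrite finset.inE -vpick0; set v := vpick _ => v0.
    have vAX : v \in (graph A :&: X)%VS by exact: memv_pick.
    have scaleI : injective (fun c : F => c *: v).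
      move=> c c' /eqP; rewrite -subr_eq0 -scalerBl scaler_eq0 (negbTE v0) orbF subr_eq0.
      by move/eqP.
    have -> : #|F|.-1 = #|[set c : F | c != 0]%SET|.
      by rewrite -(cardC1 (0 : F)); apply: eq_card => c; rewrite finset.inE.
    rewrite -big_mkcondr sum1dep_card -(card_imset _ scaleI).
    apply/subset_leq_card/fintype.subsetP => _ /imsetP[c + ->].
    rewrite !finset.inE => c0; move: vAX; rewrite memv_cap => /andP[vA vX].
    by rewrite !memvZ // scaler_eq0 (negbTE c0) (negbTE v0).
  rewrite exchange_big /=.
  apply: (@leq_trans (\sum_(w : 'rV[F]_(k + r) | (w \in X) && (w != 0%R)) #|F| ^ (k.-1 * r))).
    apply: leq_sum => w /andP[_ w0]; apply: leq_trans (card_graph_mem w0).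
    rewrite -big_mkcondr sum1dep_card.
    by apply/subset_leq_card/fintype.subsetP => A; rewrite !finset.inE => /andP[].
  rewrite sum_nat_const expnD leq_mul2r; apply/orP; right.
  apply: (@leq_trans #|X|).
    by apply/subset_leq_card/fintype.subsetP => w; rewrite unfold_in /= => /andP[].
  by rewrite card_vspace leq_exp2l.
(* The constant 2 comes from q <= 2 (q - 1). *)
rewrite -(leq_pmul2r (ltnW q2)).
apply: (@leq_trans (2 * (#|B| * #|F|.-1))); first last.
  by rewrite -mulnA -expnSr -addSn leq_mul2l.
rewrite mulnCA leq_mul2l; apply/orP; right; move: q2; case: #|F| => // c; lia.
Qed.

End Graph.

(** Transfers the construction from matrices to subspaces. Distinct matrices in [S] have distinct
    graphs, since a common graph would be its own intersection, of dimension k > 0. *)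
Lemma almost_sparse_graphs (F : finFieldType) (k r L : nat) (S : {set 'M[F]_(k, r)}) :
  (0 < k)%N ->
  {in S &, forall A B, A != B -> (graph A :&: graph B)%VS = 0%VS} ->
  (forall W : {vspace 'rV[F]_(k + r)}, \dim W = k.+1 ->
    #|[set A in S | (graph A :&: W)%VS != 0%VS]%SET| <= L)%N ->
  almost_sparse k L [set graph A | A in S]%SET /\ #|[set graph A | A in S]%SET| = #|S|.
Proof.
move=> k0 disjS sparseS.
have graphI : {in S &, injective (@graph F k r)}.
  move=> A B AS BS eAB; apply/eqP; apply: contraTT k0 => /(disjS _ _ AS BS).
  by rewrite -eAB capvv lt0n negbK => A0; rewrite -(dim_graph A) A0 dimv0.
split; last exact: card_in_imset.
apply/andP; split; first apply/andP; first split.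
- by apply/forall_inP => _ /imsetP[A _ ->]; rewrite dim_graph.
- apply/forall_inP => _ /imsetP[A AS ->]; apply/forall_inP => _ /imsetP[B BS ->].
  by apply/implyP => neqAB; apply/eqP/disjS => //; apply: contraNneq neqAB => ->.
- apply/forallP => W; apply/implyP => /eqP /sparseS; apply: leq_trans.
  apply: leq_trans (leq_imset_card (@graph F k r) _).
  apply/subset_leq_card/fintype.subsetP => U; rewrite finset.inE.
  by case/andP => /imsetP[A AS ->] AW; apply: imset_f; rewrite finset.inE AS.
Qed.

(** * Choice of parameters for a nonnegative exponent *)

Lemma expR1_ge_pow (R : realType) (m : nat) : (1 + m%:R^-1) ^+ m <= expR 1 :> R.
Proof.
have [->|m0] := posnP m; first by rewrite expr0 -expR0 ler_expR.
rewrite -[X in expR X](@mulfV R m%:R) ?pnatr_eq0 -?lt0n // expRM_natl; apply: lerXn2r;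
  rewrite ?nnegrE ?expR_ge0 ?expR_ge1Dx //.
Qed.

Lemma almost_sparse_pos_exponent (R : realType) (F : finFieldType) (k r L : nat) :
  let Q : R := #|F|%:R in
  let e : R := r%:R - k%:R - r%:R * (k%:R + 1) / (L%:R + 1) in
  (0 < k)%N -> (k < r)%N -> 0 <= e -> expR 1 * 2 ^+ k.+1 * 8 ^+ L.+1 < Q ->
  exists Fam : {set {vspace 'rV[F]_(k + r)}},
    almost_sparse k L Fam /\ Q `^ e <= #|Fam|%:R.
Proof.
move=> Q e k0 kr e0 Qbig.
have E1 : 1 <= expR 1 :> R by rewrite -expR0 ler_expR.
have Q8 : 8 ^+ L.+1 <= Q.
  apply: le_trans (ltW Qbig); rewrite ler_peMl ?exprn_ge0 //.
  by rewrite mulr_ege1 ?exprn_ege1 // ler1n.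
have Q1 : 1 <= Q by apply: le_trans Q8; rewrite exprn_ege1 // ler1n.
have Q0 : 0 < Q by lra.
pose a : R := r%:R * (k%:R + 1) / (L%:R + 1).
(* The 8 absorbs three factors 2: one in the greedy condition, one in [b] and one in [m_le]. *)
pose lam : R := Q `^ a / 8.
(* Adding 1 to the truncation gives m >= Q^e; since e >= 0 makes Q^e >= 1, it also keeps m <= 2
   Q^e. *)
pose m := (Num.trunc (Q `^ e)).+1.
pose b := (2 * #|F| ^ (k + k.-1 * r))%N.
pose D : {set {vspace 'rV[F]_(k + r)}} := [set W | \dim W == k.+1]%SET.
have Qe1 : 1 <= Q `^ e by rewrite -(powRr0 Q) ler_powR.
have m_ge : Q `^ e <= m%:R by rewrite ltW // truncnS_gt.
have m_le : m%:R <= 2 * Q `^ e.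
  have : (Num.trunc (Q `^ e))%:R <= Q `^ e by rewrite truncn_le powR_ge0.
  by rewrite /m -[(_.+1)%:R]natr1; lra.
have lamX : lam ^+ L.+1 = Q ^+ (r * k.+1) / 8 ^+ L.+1.
  rewrite expr_div_n -(powR_mulrn L.+1) ?powR_ge0 // -powRrM /a -natr1 mulfVK; last first.
    by rewrite natr1 pnatr_eq0.
  by rewrite natr1 -natrM powR_mulrn // ltW.
have lam0 : 0 <= lam by rewrite divr_ge0 ?powR_ge0.
have lam1 : 1 <= lam.
  rewrite -(@expr_ge1 _ L.+1) // lamX ler_pdivlMr ?exprn_gt0 // mul1r.
  apply: le_trans Q8 _; rewrite -[leLHS]expr1 ler_weXn2l // muln_gt0.
  by rewrite (leq_trans _ kr).
have sizes : 2 * lam * b%:R * m%:R <= #|{: 'M[F]_(k, r)}|%:R.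
  rewrite card_mx natrX -/Q /b natrM natrX -/Q.
  (* The surplus exponent r - k of |T| over [b] is exactly a + e. *)
  have -> : (k * r = (k + k.-1 * r) + (r - k))%N.
    by rewrite -{1}(prednK k0) mulSn; lia.
  have -> : Q ^+ ((k + k.-1 * r) + (r - k)) = Q ^+ (k + k.-1 * r) * (Q `^ a * Q `^ e).
    rewrite exprD; congr (_ * _); rewrite -powRD; last by rewrite (gt_eqF Q0) implybT.
    by rewrite -(powR_mulrn _ (ltW Q0)) (natrB _ (ltnW kr)) /a /e; congr (_ `^ _); ring.
  have : 0 <= Q ^+ (k + k.-1 * r) * Q `^ a by rewrite mulr_ge0 ?exprn_ge0 ?powR_ge0 // ltW.
  rewrite /lam; move: (Q ^+ _) (Q `^ a) (Q `^ e) m_le => x y z mz xy0.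
  have := ler_wpM2l xy0 mz; lra.
have cardD : expR 1 * #|D|%:R < lam ^+ L.+1.
  have := card_dim_vspace_le F k (k + r); rewrite -/D -(ler_nat R) !natrM !natrX -/Q.
  rewrite lamX ltr_pdivlMr ?exprn_gt0 //.
  have Qk0 : 0 < Q ^+ (k.+1 * k.+1) by rewrite exprn_gt0.
  rewrite -(ltr_pM2r Qk0) -exprD => /(ler_wpM2l (_ : 0 <= expR 1 * 8 ^+ L.+1)).
  rewrite mulr_ge0 ?expR_ge0 ?exprn_ge0 // => /(_ isT) cD.
  have -> : expR 1 * #|D|%:R * 8 ^+ L.+1 * Q ^+ (k.+1 * k.+1) =
      expR 1 * 8 ^+ L.+1 * (#|D|%:R * Q ^+ (k.+1 * k.+1)).
    by rewrite [RHS]mulrA; congr (_ * _); rewrite mulrAC.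
  apply: le_lt_trans cD _.
  (* Since |D| <= 2^(k+1) Q^((k+1)(r-1)), a factor Q^(k+1) is spare; it dominates the constants
     bounded by [Qbig]. *)
  rewrite (_ : (r * k.+1 + k.+1 * k.+1 = k.+1 * (k + r) + k.+1)%N); last by lia.
  rewrite exprD.
  rewrite [ltLHS]mulrA [ltLHS]mulrC [_ * 8 ^+ _ * _]mulrAC.
  rewrite ltr_pM2l ?exprn_gt0 //; apply: lt_le_trans Qbig _.
  by rewrite -[leLHS]expr1 ler_weXn2l.
have meetC : symmetric (fun A B : 'M[F]_(k, r) => (graph A :&: graph B)%VS != 0%VS).
  by move=> A B; rewrite capvC.
have meetR : reflexive (fun A B : 'M[F]_(k, r) => (graph A :&: graph B)%VS != 0%VS).
  by move=> A; rewrite capvv -dimv_eq0 dim_graph -lt0n.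
have M0 : (0 < #|{: 'M[F]_(k, r)}|)%N.
  by rewrite card_mx expn_gt0 (ltnW (finNzRing_gt1 F)).
have meet_b (A : 'M[F]_(k, r)) :
    (#|[set B | (graph A :&: graph B)%VS != 0%VS]%SET| <= b)%N.
  apply: leq_trans (card_graph_meet (d := k) (X := graph A) _); last by rewrite dim_graph.
  by apply/subset_leq_card/fintype.subsetP => B; rewrite !finset.inE capvC.
have hit_b W : W \in D -> (#|[set A | (graph A :&: W)%VS != 0%VS]%SET| <= b)%N.
  by rewrite finset.inE => /eqP dimW; apply: card_graph_meet; rewrite dimW.
have [S [cardS disjS sumS]] := greedy_family lam1 (isT : (0 < m)%N) M0 meetC meetR
  meet_b hit_b sizes (leqnn m).
have [||AS card_im] := @almost_sparse_graphs F k r L S k0.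
- by move=> A B AinS BinS /(disjS _ _ AinS BinS) /negPn/eqP.
(* If W met more than L graphs, its term alone would be at least lam^(L+1), already exceeding the
   whole potential. *)
- move=> W dimW; rewrite leqNgt; apply: contraTN cardD => big.
  rewrite -leNgt; apply: (@le_trans _ _ (lam ^+ #|[set A in S | (graph A :&: W)%VS != 0%VS]%SET|)).
    by rewrite ler_weXn2l.
  apply: le_trans (_ : #|D|%:R * (1 + m%:R^-1) ^+ m <= _); last first.
    by rewrite mulrC ler_wpM2r // expR1_ge_pow.
  apply: le_trans sumS; rewrite (bigD1 W) /=; last by rewrite finset.inE dimW.
  by rewrite lerDl sumr_ge0 // => *; rewrite exprn_ge0.
by exists [set graph A | A in S]%SET; split; rewrite // card_im cardS.
Qed.

(** * Negative exponents and the asymptotic statement *)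

Lemma almost_sparse_single (F : finFieldType) (k r L : nat) : (0 < k)%N -> (0 < L)%N ->
  exists Fam : {set {vspace 'rV[F]_(k + r)}}, almost_sparse k L Fam /\ #|Fam| = 1%N.
Proof.
move=> k0 L0; have [||AS card_im] := @almost_sparse_graphs F k r L [set 0]%SET k0.
- by move=> A B /finset.set1P-> /finset.set1P->; rewrite eqxx.
- move=> W _; apply: leq_trans L0; rewrite -[X in (_ <= X)%N](cards1 (0 : 'M[F]_(k, r))).
  by apply/subset_leq_card/fintype.subsetP => A; rewrite finset.inE => /andP[].
by exists [set graph A | A in [set 0]]%SET; split; rewrite // card_im cards1.
Qed.

(** The threshold is uniform over finite fields, so it serves both an arbitrary field with q
    elements and the chosen [Fq q]. *)
Lemma almost_sparse_eventually (R : realType) (n k L : nat) :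
  let e : R := n%:R - 2 * k%:R - (n%:R - k%:R) * (k%:R + 1) / (L%:R + 1) in
  (0 < k)%N -> (0 < L)%N -> (2 * k < n)%N ->
  exists q0 : nat, forall F : finFieldType, (q0 <= #|F|)%N ->
  exists Fam : {set {vspace 'rV[F]_n}},
    almost_sparse k L Fam /\ #|F|%:R `^ e <= #|Fam|%:R.
Proof.
move=> e k0 L0 kn; pose r := (n - k)%N.
have nE : n = (k + r)%N by rewrite /r; lia.
have kr : (k < r)%N by rewrite /r; lia.
have eE : e = r%:R - k%:R - r%:R * (k%:R + 1) / (L%:R + 1).
  by rewrite /e nE natrD; ring.
rewrite eE; clearbody r; move: (n) nE => _ -> {n kn e eE}.
have [e0|e0] := leP 0 (r%:R - k%:R - r%:R * (k%:R + 1) / (L%:R + 1) : R).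
  exists (Num.trunc (expR 1 * 2 ^+ k.+1 * 8 ^+ L.+1 : R)).+1 => F q_big.
  apply: almost_sparse_pos_exponent => //.
  by apply: lt_le_trans (truncnS_gt _) _; rewrite ler_nat.
exists 0%N => F _; have [Fam [AS cardFam]] := almost_sparse_single F r k0 L0.
exists Fam; split=> //; rewrite cardFam.
have F1 : 1 <= #|F|%:R :> R by rewrite ler1n ltnW // finNzRing_gt1.
by apply: le_trans (ler_powR F1 (ltW e0)) _; rewrite powRr0.
Qed.

Theorem theorem2 (R : realType) (n k L : nat)
    (hn : (0 < n)%N) (hk : (0 < k)%N) (hL : (0 < L)%N) (hkn : (2 * k < n)%N) :
  let e : R := n%:R - 2 * k%:R - (n%:R - k%:R) * (k%:R + 1) / (L%:R + 1) in
  (exists eps : nat -> R,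
     eps @ within prime_power \oo --> (0 : R) /\
     forall q : nat, prime_power q ->
     forall F : finFieldType, #|F| = q ->
     exists Fam : {set {vspace 'rV[F]_n}},
       almost_sparse k L Fam /\
       q%:R `^ e * (1 + eps q) <= #|Fam|%:R) /\
  (e%:E <= pAS R n k L)%E.
Proof.
move=> e; have [q0 AS_q0] := @almost_sparse_eventually R n k L hk hL hkn.
split.
  (* Below [q0] the value -1 makes the required size 0, so the empty family suffices; the error
     vanishes from [q0] on. *)
  exists (fun q => if (q0 <= q)%N then 0 else -1); split.
    apply: cvg_near_cst; apply: cvg_within; near=> q.
    by rewrite ifT //; near: q; exact: nbhs_infty_ge.
  move=> q q_pp F <-; case: ifPn => q_big.
    by have [Fam [AS leF]] := AS_q0 F q_big; exists Fam; rewrite addr0 mulr1.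
  exists finset.set0; rewrite subrr mulr0; split => //.
  apply/andP; split; first apply/andP; first split.
  - by apply/forall_inP => U; rewrite finset.inE.
  - by apply/forall_inP => U; rewrite finset.inE.
  - apply/forallP => W; apply/implyP => _; rewrite (_ : finset _ = finset.set0) ?cards0 //.
    by apply/setP => U; rewrite !finset.inE.
(* The limsup is an infimum of suprema over sets A containing all prime powers from some N on. In
   each A, one prime above both [q0] and N already bounds the supremum below by e. *)
rewrite /pAS limf_esupE; apply: le_ereal_inf_tmp => _ [A [N _ NA] <-].
have [p p_gt p_pr] := prime_above (maxn q0 N).
have [q0p Np] : (q0 <= p)%N /\ (N <= p)%N by split; lia.
have p_pp : prime_power p by exists p, 1%N; rewrite expn1.
have [|Fam [AS]] := AS_q0 (Fq p); rewrite card_Fq // => leFam.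
apply: le_trans (_ : _ <= (ln (mAS p n k L)%:R / ln p%:R)%:E)%E _; last first.
  by apply: ereal_sup_ubound; exists p => //; apply: NA.
have p1 : 1 < p%:R :> R by rewrite ltr1n prime_gt1.
have pe_gt0 : 0 < p%:R `^ e by rewrite powR_gt0 // (lt_trans ltr01).
have le_mAS : p%:R `^ e <= (mAS p n k L)%:R.
  by apply: le_trans leFam _; rewrite ler_nat; apply: leq_bigmax_cond.
rewrite lee_fin ler_pdivlMr ?ln_gt0 // -ln_powR ler_ln ?posrE //.
exact: lt_le_trans le_mAS.
Unshelve. all: by end_near.
Qed.
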